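(* Let $d\in\mathbb{N}$, let $\sigma(x)=\frac{1}{1+e^{-x}}$ be the logistic function, and let $r\in\mathbb{N}$. For each abstract modulus of smoothness $\omega$ satisfying $\lim_{\delta\to 0+}\frac{\omega(\delta)}{\delta}=\infty$, a counterexample $f_\omega\in C([0,1]^d)$ exists such that for $\delta\to 0+$ $$\omega_r(f_\omega,\delta)_{\infty,(0,1)^d}=O(\omega(\delta^r))$$ and for $n\to\infty$ $$E(\mathcal{M}_n,f_\omega)_{\infty,(0,1)^d}\neq o\left(\omega\left(\frac{1}{(n[1+\log_2(n)])^{\frac{r}{d}}}\right)\right).$$
   Context: For an activation function $\sigma:\mathbb{R}\to\mathbb{R}$ and $n\in\mathbb{N}$, $\mathcal{M}_n=\mathcal{M}_{n,\sigma}:=\left\{\mathbf{x}\mapsto\sum_{k=1}^n a_k\sigma(\mathbf{w}_k\cdot\mathbf{x}+c_k): a_k,c_k\in\mathbb{R},\ \mathbf{w}_k\in\mathbb{R}^d\right\}$ (functions on $\mathbb{R}^d$), where $\cdot$ is the standard inner product. $E(S,f)_{\infty,(0,1)^d}:=\inf\{\|f-g\|_{C([0,1]^d)}:g\in S\}$ with the sup-norm. An abstract modulus of smoothness is a continuous, increasing function $\omega:[0,\infty)\to[0,\infty)$ such that for all $\delta_1,\delta_2>0$: $0=\omega(0)<\omega(\delta_1)\leq\omega(\delta_1+\delta_2)\leq\omega(\delta_1)+\omega(\delta_2)$. For open $\Omega\subset\mathbb{R}^d$, $\boldsymbol{\nu}\in\mathbb{R}^d$, let $\Delta_{\boldsymbol{\nu}}^r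 f(\mathbf{x}):=\sum_{j=0}^r(-1)^{r-j}\binom{r}{j}f(\mathbf{x}+j\boldsymbol{\nu})$ and $\Omega(\boldsymbol{\nu}):=\{\mathbf{x}\in\Omega:\mathbf{x}+t\boldsymbol{\nu}\in\Omega,\ 0\leq t\leq 1\}$. The $r$th radial modulus of smoothness of $f\in C(\overline{\Omega})$ is $\omega_r(f,\delta)_{\infty,\Omega}:=\sup\{\|\Delta_{\boldsymbol{\nu}}^r f\|_{C(\overline{\Omega(r\boldsymbol{\nu})})}:\boldsymbol{\nu}\in\mathbb{R}^d,\ |\boldsymbol{\nu}|\leq\delta\}$ (sup-norms). $b_n\neq o(a_n)$ means $\limsup_{n\to\infty}b_n/a_n>0$ (for $b_n\geq 0$, $a_n>0$). *)

(* Defs.v *)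
From HB Require Import structures.
From mathcomp Require Import all_boot all_order all_algebra.
From mathcomp Require Import all_classical all_reals all_analysis.

Set Implicit Arguments.
Unset Strict Implicit.
Unset Printing Implicit Defensive.

Import Order.TTheory GRing.Theory Num.Theory numFieldNormedType.Exports.

Local Open Scope classical_set_scope.
Local Open Scope ring_scope.

(* The library norm on 'rV[R]_d is the maximum norm, hence [dotv] and [enorm].
   Only the topology of 'rV[R]_d is taken from the library. *)
Definition dotv (R : realType) (d : nat) (u v : 'rV[R]_d) : R :=
  \sum_(i < d) u 0 i * v 0 i.

Definition enorm (R : realType) (d : nat) (u : 'rV[R]_d) : R :=
  Num.sqrt (dotv u u).

(* Meant for g bounded on K; it is 0 for empty K because sup set0 = 0. *)
Definition sup_norm (R : realType) (d : nat) (K : set 'rV[R]_d)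
    (g : 'rV[R]_d -> R) : R :=
  sup [set `|g x| | x in K].

Definition open_cube (R : realType) (d : nat) : set 'rV[R]_d :=
  [set x | forall i, 0 < x 0 i < 1].

Definition closed_cube (R : realType) (d : nat) : set 'rV[R]_d :=
  [set x | forall i, 0 <= x 0 i <= 1].

Arguments open_cube : clear implicits.
Arguments closed_cube : clear implicits.

Definition logistic (R : realType) (x : R) : R := 1 / (1 + expR (- x)).

Definition networks (R : realType) (sigma : R -> R) (d n : nat) :
    set ('rV[R]_d -> R) :=
  [set g | exists (a c : 'I_n -> R) (w : 'I_n -> 'rV[R]_d),
     g = fun x => \sum_(k < n) a k * sigma (dotv (w k) x + c k)].

Arguments networks {R} sigma d n _.

Definition approx_error (R : realType) (d : nat) (S : set ('rV[R]_d -> R))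
    (f : 'rV[R]_d -> R) : R :=
  inf [set sup_norm (closed_cube R d) (fun x => f x - g x) | g in S].

Definition fdiff (R : realType) (d r : nat) (nu : 'rV[R]_d)
    (f : 'rV[R]_d -> R) (x : 'rV[R]_d) : R :=
  \sum_(j < r.+1) (-1) ^+ (r - j) * 'C(r, j)%:R * f (x + j%:R *: nu).

Definition shift_domain (R : realType) (d : nat) (Omega : set 'rV[R]_d)
    (nu : 'rV[R]_d) : set 'rV[R]_d :=
  [set x | Omega x /\ forall t : R, 0 <= t <= 1 -> Omega (x + t *: nu)].

Definition radial_modulus (R : realType) (d : nat) (Omega : set 'rV[R]_d)
    (r : nat) (f : 'rV[R]_d -> R) (delta : R) : R :=
  sup [set sup_norm (closure (shift_domain Omega (r%:R *: nu))) (fdiff r nu f)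
      | nu in [set nu : 'rV[R]_d | enorm nu <= delta]].

(* A function [0, oo) -> [0, oo) is represented by a function on R whose values
   at negative arguments are irrelevant. *)
Definition abstract_modulus (R : realType) (omega : R -> R) : Prop :=
  [/\ forall t : R, 0 <= t -> 0 <= omega t,
      {within `[0, +oo[, continuous omega},
      {in `[0, +oo[ &, {homo omega : s t / s <= t}},
      omega 0 = 0 &
      forall s t : R, 0 < s -> 0 < t ->
        [/\ 0 < omega s, omega s <= omega (s + t) &
            omega (s + t) <= omega s + omega t]].

Definition log2 (R : realType) (x : R) : R := ln x / ln 2.

(* Main.v *)
Require Import Defs.
From HB Require Import structures.
From mathcomp Require Import all_boot all_order all_algebra.
From mathcomp Require Import all_classical all_reals all_analysis.
From mathcomp Require Import ring lra zify.

Import Order.TTheory GRing.Theory Num.Theory numFieldNormedType.Exports.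

Local Open Scope classical_set_scope.
Local Open Scope ring_scope.

Set Implicit Arguments.
Unset Strict Implicit.
Unset Printing Implicit Defensive.

(** Why the theorem is true.

    The function is a gliding hump
      f = sum_j omega(phi_j) g_j,  phi_j = (n_j (1 + log2 n_j))^(-r/d),
    where the widths n_j are sparse and g_j is a sum of disjoint bumps with
    signs, one bump for each point of a grid with N_j points per axis; N_j^d is
    n_j (1 + log2 n_j) up to a constant factor, so that N_j^r is at most a
    constant times 1/phi_j.

    Smoothness.  The r-th differences of g_j with step nu are bounded by a
    constant times min(1, |nu|^r / phi_j) ([fdiff_bumps_le]); hence those of f
    with |nu|^r <= t are bounded by a constant times
    sum_j omega(phi_j) min(1, t / phi_j).  The n_j are so sparse that
    omega(phi_j) decreases geometrically and omega(phi_j) / phi_j increases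
    geometrically, which is possible because omega(t) / t is unbounded at 0.
    The sum is then governed by the two terms with phi_j next to t, and
    subadditivity bounds both by a multiple of omega(t).

    Lower bound.  The signs of g_J are chosen after the partial sum F of the
    preceding humps: they are such that no network of width n_J stays within
    omega(phi_J) / 4 of F + omega(phi_J) g_J on the whole grid.  The humps that
    follow are too small to change this.  Choosing the signs last means that F
    itself need not be approximated well by networks.

    Such signs exist by a dimension count ([exists_unmatched_signs]).  At a grid
    point, a network of width n is a rational function of the n (d + 2)
    quantities a_k, exp(- c_k), exp(- w_ki / N), of degree at most n N in each.
    Suppose that every sign vector s on the grid is matched by some weights up
    to an error 1/4.  A few iterations of u |-> (3 u - u^3) / 2, for which +-1
    are attracting fixed points, reduce the error to 1 / (4 N^d) at a polynomial
    cost in the degree.  Then the functions prod_p (1 + s_p u_p), after a common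
    denominator is cleared, form a family of 2^(N^d) polynomials whose values at
    the weights matching the sign vectors make a diagonally dominant matrix.
    They are linearly independent, although there are only 2^(O(n log n))
    monomials to express them: a contradiction when the constant in
    N^d = O(n (1 + log2 n)) is large ([hard_width_count]).

    The construction of f from such humps is [gliding_hump]. *)

(** * Functions that are polynomial or rational in finitely many quantities *)

Lemma linear_dependence (K : fieldType) (S E : finType) (C : S -> E -> K) :
  (#|E| < #|S|)%N ->
  exists2 v : S -> K, (exists s, v s != 0) & forall e, \sum_s v s * C s e = 0.
Proof.
move=> ltES.
pose M := \matrix_(i < #|S|, j < #|E|) C (enum_val i) (enum_val j).
have /rowV0Pn[u /sub_kermxP uM u0] : kermx M != 0.
  rewrite kermx_eq0 /row_free neq_ltn; apply/orP; left.
  exact: leq_ltn_trans (rank_leq_col M) ltES.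
exists (fun s => u 0 (enum_rank s)) => [|e].
  have /rV0Pn[i ui] := u0; exists (enum_val i); by rewrite enum_valK.
have /rowP/(_ (enum_rank e)) := uM; rewrite !mxE => uMe; rewrite -[RHS]uMe.
rewrite (reindex_onto enum_val enum_rank) => [|s _]; last exact: enum_rankK.
by apply: eq_big => i; rewrite ?enum_valK ?eqxx // !mxE enum_rankK.
Qed.

Section PolynomialFunctions.
Variables (R : realType) (T : Type) (I : finType) (X : I -> T -> R).

(** The degree is bounded by [D] in each variable separately, so that the number
    of monomials is [D.+1 ^ #|I|].  The variables are arbitrary functions [X i]
    on a parameter space [T], because the quantities in which a network is
    rational are exponentials of its weights. *)
Definition polyfun (D : nat) (F : T -> R) : Prop :=
  exists c : {ffun I -> 'I_D.+1} -> R,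
    forall t, F t = \sum_e c e * \prod_i X i t ^+ e i.

Lemma polyfun_ext D F G : F =1 G -> polyfun D F -> polyfun D G.
Proof. by move=> FG [c cE]; exists c => t; rewrite -FG. Qed.

Lemma polyfun_monomial D (m : I -> nat) : (forall i, m i <= D)%N ->
  polyfun D (fun t => \prod_i X i t ^+ m i).
Proof.
move=> mD; pose e0 := [ffun i => inord (m i) : 'I_D.+1].
exists (fun e => (e == e0)%:R) => t.
rewrite (bigD1 e0) //= eqxx mul1r [X in _ + X]big1 ?addr0; last first.
  by move=> e ee0; rewrite (negPf ee0) mul0r.
by apply: eq_bigr => i _; rewrite ffunE inordK // ltnS.
Qed.

Lemma polyfunZ D a F : polyfun D F -> polyfun D (fun t => a * F t).
Proof.
move=> [c cE]; exists (fun e => a * c e) => t.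
by rewrite cE mulr_sumr; apply: eq_bigr => e _; rewrite mulrA.
Qed.

Lemma polyfunD D F G : polyfun D F -> polyfun D G ->
  polyfun D (fun t => F t + G t).
Proof.
move=> [c cE] [c' c'E]; exists (fun e => c e + c' e) => t.
by rewrite cE c'E -big_split; apply: eq_bigr => e _; rewrite mulrDl.
Qed.

Lemma polyfun_cst D a : polyfun D (fun=> a).
Proof.
apply: (@polyfun_ext _ (fun t => a * \prod_i X i t ^+ 0)) => [t|].
  by rewrite big1 ?mulr1.
by apply: polyfunZ; apply: polyfun_monomial.
Qed.

Lemma polyfun_sum D (J : finType) (F : J -> T -> R) :
  (forall j, polyfun D (F j)) -> polyfun D (fun t => \sum_j F j t).
Proof.
move=> FD; elim: (index_enum J) => [|j s IHs].
  by apply: polyfun_ext (polyfun_cst _ 0) => t; rewrite big_nil.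
by apply: polyfun_ext (polyfunD (FD j) IHs) => t; rewrite big_cons.
Qed.

Lemma polyfunM D D' F G : polyfun D F -> polyfun D' G ->
  polyfun (D + D') (fun t => F t * G t).
Proof.
move=> [c cE] [c' c'E].
apply: (@polyfun_ext _ (fun t => \sum_e \sum_e' (c e * c' e') *
    \prod_i X i t ^+ (e i + e' i))) => [t|].
  rewrite cE c'E mulr_suml; apply: eq_bigr => e _.
  rewrite mulr_sumr; apply: eq_bigr => e' _.
  rewrite mulrACA -big_split; congr (_ * _).
  by apply: eq_bigr => i _; rewrite exprD.
apply: polyfun_sum => e; apply: polyfun_sum => e'; apply: polyfunZ.
by apply: polyfun_monomial => i; rewrite leq_add // -ltnS.
Qed.

Lemma polyfun_prod D (J : finType) (F : J -> T -> R) :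
  (forall j, polyfun D (F j)) -> polyfun (#|J| * D) (fun t => \prod_j F j t).
Proof.
move=> FD; rewrite -sum_nat_const; elim: (index_enum J) => [|j s IHs].
  by rewrite big_nil; apply: polyfun_ext (polyfun_cst _ 1) => t;
    rewrite big_nil.
by rewrite big_cons; apply: polyfun_ext (polyfunM (FD j) IHs) => t;
  rewrite big_cons.
Qed.

(** Positivity of the denominator makes it possible to clear denominators
    without changing signs, and holds for sums of logistic units. *)
Definition ratfun (D : nat) (u : T -> R) : Prop :=
  exists P Q : T -> R, [/\ polyfun D P, polyfun D Q, forall t, 0 < Q t &
    forall t, u t = P t / Q t].

Lemma ratfun_ext D u v : u =1 v -> ratfun D u -> ratfun D v.
Proof.
by move=> uv [P [Q [PD QD Q0 uE]]]; exists P, Q; split=> // t; rewrite -uv.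
Qed.

Lemma ratfun_cst a : ratfun 0 (fun=> a).
Proof.
exists (fun=> a), (fun=> 1); split; do ?exact: polyfun_cst; move=> t //.
by rewrite divr1.
Qed.

Lemma ratfunD D D' u v : ratfun D u -> ratfun D' v ->
  ratfun (D + D') (fun t => u t + v t).
Proof.
move=> [P [Q [PD QD Q0 uE]]] [P' [Q' [PD' QD' Q0' vE]]].
exists (fun t => P t * Q' t + Q t * P' t), (fun t => Q t * Q' t); split.
- by apply: polyfunD; apply: polyfunM.
- exact: polyfunM.
- by move=> t; rewrite mulr_gt0.
- by move=> t; rewrite uE vE; field; rewrite !gt_eqF.
Qed.

Lemma ratfun_sum D (J : finType) (u : J -> T -> R) :
  (forall j, ratfun D (u j)) -> ratfun (#|J| * D) (fun t => \sum_j u j t).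
Proof.
move=> uD; rewrite -sum_nat_const; elim: (index_enum J) => [|j s IHs].
  by rewrite big_nil; apply: ratfun_ext (ratfun_cst 0) => t; rewrite big_nil.
by rewrite big_cons; apply: ratfun_ext (ratfunD (uD j) IHs) => t;
  rewrite big_cons.
Qed.

Lemma ratfun_affine D a b u : ratfun D u -> ratfun D (fun t => (u t - a) / b).
Proof.
move=> [P [Q [PD QD Q0 uE]]].
exists (fun t => b^-1 * P t + - (b^-1 * a) * Q t), Q; split=> //.
  by apply: polyfunD; apply: polyfunZ.
move=> t; rewrite uE; set c := b^-1; field.
by rewrite gt_eqF.
Qed.

End PolynomialFunctions.

(** * Sharpening approximate signs *)

Section Sharpening.
Variable R : realType.

(** The cubic with fixed points 1 and -1 and vanishing derivative there, hence
    the quadratic decrease of the error below. *)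
Definition sharpen (u : R) : R := (3 * u - u ^+ 3) / 2.

Lemma sharpen_error (s u h : R) : s ^+ 2 = 1 -> `|u - s| <= h -> h <= 1 ->
  `|sharpen u - s| <= 2 * h ^+ 2.
Proof.
move=> s2; set k := u - s => kh h1.
have -> : sharpen u - s = - ((3 * s + k) * k ^+ 2 / 2).
  have -> : u = s + k by rewrite /k; ring.
  have s3 : s ^+ 3 = s by rewrite exprS s2 mulr1.
  rewrite /sharpen.
  transitivity (s / 2 + 3 / 2 * k - s ^+ 3 / 2 - 3 / 2 * s ^+ 2 * k
     - (3 * s + k) * k ^+ 2 / 2); first by field.
  by rewrite s2 s3; field.
have s1 : `|s| = 1 by apply/eqP; rewrite -sqrp_eq1 // -normrX s2 normr1.
rewrite normrN normrM normfV normrM normrX (ger0_norm (_ : 0 <= 2)) //.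
have k2 : `|k| ^+ 2 <= h ^+ 2 by rewrite lerXn2r // nnegrE (le_trans _ kh).
have : `|3 * s + k| <= 4.
  by rewrite (le_trans (ler_normD _ _)) // normrM s1 ger0_norm //; lra.
have := sqr_ge0 `|k|; nra.
Qed.

Lemma iter_sharpen_error (s u : R) (k : nat) : s ^+ 2 = 1 ->
  `|u - s| <= 1 / 4 -> 2 * `|iter k sharpen u - s| <= (1 / 2) ^+ (2 ^ k).
Proof.
move=> s2 us; elim: k => [|k IHk] /=; first by rewrite expn0 expr1; lra.
set h := `|_ - _| in IHk.
have h1 : h <= 1.
  have : (1 / 2 : R) ^+ (2 ^ k) <= 1 by rewrite exprn_ile1 //; lra.
  lra.
have := sharpen_error s2 (lexx h) h1.
move=> H; apply: (@le_trans _ _ ((2 * h) ^+ 2)); first by rewrite exprMn; lra.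
by rewrite expnSr exprM lerXn2r // nnegrE ?mulr_ge0 // ?normr_ge0 // exprn_ge0
  //; lra.
Qed.

Lemma iter_sharpen_error_card (s u : R) (m k : nat) : s ^+ 2 = 1 ->
  (0 < m <= 2 ^ k)%N -> `|u - s| <= 1 / 4 ->
  `|iter k sharpen u - s| <= (4 * m%:R)^-1.
Proof.
move=> s2 /andP[m0 mk] us.
have := iter_sharpen_error k s2 us.
suff : (1 / 2 : R) ^+ (2 ^ k) <= (2 * m%:R)^-1.
  by rewrite !invfM; set c := m%:R^-1; lra.
rewrite mul1r exprVn lef_pV2 ?posrE ?exprn_gt0 ?mulr_gt0 ?ltr0n //.
rewrite -natrM -natrX ler_nat.
apply: (@leq_trans (2 ^ m)); last by rewrite leq_exp2l.
case: m m0 {mk us} => // m _; rewrite expnS leq_mul2l /=.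
by rewrite ltn_expl.
Qed.

Lemma ratfun_sharpen (T : Type) (I : finType) (X : I -> T -> R) D u k :
  ratfun X D u -> ratfun X (3 ^ k * D) (fun t => iter k sharpen (u t)).
Proof.
elim: k => [|k IHk] uD; first by rewrite mul1n.
have [P [Q [PD QD Q0 uE]]] := IHk uD.
rewrite expnS -mulnA; set D' := (3 ^ k * D)%N in PD QD *.
have D3 : (3 * D' = D' + D' + D')%N by rewrite !mulSn mul0n addn0 addnA.
have M3 F G H : polyfun X D' F -> polyfun X D' G -> polyfun X D' H ->
    polyfun X (3 * D') (fun t => F t * G t * H t).
  by rewrite D3 => *; do 2?apply: polyfunM.
exists (fun t => 3 * (P t * Q t * Q t) + (- 1) * (P t * P t * P t)),
  (fun t => 2 * (Q t * Q t * Q t)); split.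
- by apply: polyfunD; apply: polyfunZ; apply: M3.
- by apply: polyfunZ; apply: M3.
- by move=> t; rewrite !mulr_gt0.
- by move=> t; rewrite /= uE /sharpen; field; rewrite gt_eqF.
Qed.

End Sharpening.

(** * Rational functions cannot match all sign vectors *)

Lemma bernoulli_sub (R : realType) (x : R) m : 0 <= x <= 1 ->
  1 - m%:R * x <= (1 - x) ^+ m.
Proof.
move=> /andP[x0 x1]; elim: m => [|m IHm]; first by rewrite mul0r subr0.
rewrite exprS -natr1; have : 0 <= m%:R :> R by []; nra.
Qed.

Section SignPatterns.
Variables (R : realType) (T : Type) (I G : finType) (X : I -> T -> R).

Let sgn (b : bool) : R := (-1) ^+ b.

Let sgn2 b : sgn b ^+ 2 = 1.
Proof. by rewrite /sgn sqrr_sign. Qed.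

(** The sum is [2 * Num.max 1 `|x|]. *)
Let sum_sgn (x e : R) b : `|x - sgn b| <= e ->
  \sum_c `|1 + sgn c * x| <= 2 * (1 + e).
Proof.
rewrite big_bool /sgn /= expr1 expr0; case: b; rewrite ?expr1 ?expr0 => xe.
all: move: xe; rewrite ler_norml => /andP[xe1 xe2].
all: case: (lerP 0 (1 + -1 * x)) => h1; case: (lerP 0 (1 + 1 * x)) => h2.
all: rewrite ?(ger0_norm h1) ?(ger0_norm h2) ?(ltr0_norm h1) ?(ltr0_norm h2);
  lra.
Qed.

(** If weights [t_ s] matched every [s], the matrix of the numbers
    [\prod_p (1 + s p * u p (t_ s'))] would be diagonally dominant: at
    [s = s'] each factor is about 2, and the sum over all [s] factors into a
    product of sums that are also about 2.  With more sign vectors than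
    monomials, however, the corresponding polynomials are linearly dependent. *)
Lemma exists_unmatched_sharp_signs D (u : G -> T -> R) :
  (forall p, ratfun X D (u p)) -> ((#|G| * D).+1 ^ #|I| < 2 ^ #|G|)%N ->
  exists s : {ffun G -> bool}, forall t,
    exists p, (4 * #|G|%:R)^-1 < `|u p t - (-1) ^+ s p|.
Proof.
move=> uD card_lt; apply: contrapT => no_s.
have {no_s} near_all (s : {ffun G -> bool}) :
    exists t, forall p, `|u p t - sgn (s p)| <= (4 * #|G|%:R)^-1.
  apply: contrapT => no_t; apply: no_s; exists s => t.
  apply: contrapT => no_p; apply: no_t; exists t => p.
  by rewrite leNgt; apply/negP => ltp; apply: no_p; exists p.
have [P PQ] := choice uD; have {PQ}[Q PQ] := choice PQ.
pose F (s : {ffun G -> bool}) t := \prod_p (Q p t + sgn (s p) * P p t).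
have FD s : polyfun X (#|G| * D) (F s).
  apply: polyfun_prod => p; have [PD QD _ _] := PQ p.
  by apply: polyfunD => //; apply: polyfunZ.
have [c cE] := choice FD.
have [|v [s1 vs1] vc] := linear_dependence c.
  by rewrite !card_ffun card_ord card_bool.
have vF t : \sum_s v s * F s t = 0.
  under eq_bigr do rewrite cE mulr_sumr.
  rewrite exchange_big big1 //= => e _.
  under eq_bigr do rewrite mulrA.
  by rewrite -mulr_suml vc mul0r.
pose s0 := [arg max_(s > s1) `|v s|]%O.
have vmax s : `|v s| <= `|v s0|.
  by rewrite /s0; case: arg_maxP => // i _; apply.
have v0 : 0 < `|v s0| by rewrite (lt_le_trans _ (vmax s1)) // normr_gt0.
have [t near_t] := near_all s0.
pose f (s : {ffun G -> bool}) := \prod_p `|1 + sgn (s p) * u p t|.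
have QF s : `|F s t| = `|\prod_p Q p t| * f s.
  rewrite /F /f -normr_prod -normrM -big_split; congr `|_|.
  apply: eq_bigr => p _ /=; have [_ _ Q0 uE] := PQ p.
  by rewrite uE; field; rewrite gt_eqF.
have Q0 : 0 < `|\prod_p Q p t|.
  by rewrite normr_gt0; apply/prodf_neq0 => p _; rewrite gt_eqF //;
    case: (PQ p).
(* The coefficient of s0 is maximal, so the dependence relation at weights that
   match s0 bounds its term by the sum of all the others. *)
have f_s0 : f s0 *+ 2 <= \sum_s f s.
  rewrite (bigD1 s0) //= mulr2n lerD2l -(ler_pM2l Q0) -QF mulr_sumr.
  rewrite -(ler_pM2l v0) -normrM.
  move: (vF t); rewrite (bigD1 s0) //= => /eqP; rewrite addr_eq0 => /eqP ->.
  rewrite normrN (le_trans (ler_norm_sum _ _ _)) // mulr_sumr.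
  apply: ler_sum => s _; rewrite normrM -QF ler_wpM2r //.
set m := #|G| in card_lt near_t.
have m0 : (0 < m)%N.
  by rewrite lt0n; apply: contraTneq card_lt => ->; rewrite mul0n exp1n.
set e := (4 * m%:R)^-1 in near_t.
have me : m%:R * e = 1 / 4.
  by rewrite /e; field; rewrite pnatr_eq0 -lt0n.
have e0 : 0 <= e by rewrite invr_ge0 mulr_ge0.
have e1 : e <= 1.
  by have : (1 : R) <= m%:R; [rewrite ler1n | nra].
have lower : (2 * (1 - e / 2)) ^+ m <= f s0.
  rewrite /f -prodr_const; apply: ler_prod => p _; apply/andP; split; first lra.
  have -> : 1 + sgn (s0 p) * u p t = 2 + sgn (s0 p) * (u p t - sgn (s0 p)).
    by rewrite mulrBr -expr2 sgn2; ring.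
  have := lerB_normD 2 (sgn (s0 p) * (u p t - sgn (s0 p))).
  by rewrite normrM normr_sign mul1r (ger0_norm (ler0n R 2)) => h;
    have := near_t p; lra.
have upper : \sum_s f s <= (2 * (1 + e)) ^+ m.
  rewrite -(bigA_distr_bigA (fun p b => `|1 + sgn b * u p t|)) /=.
  rewrite -prodr_const; apply: ler_prod => p _; rewrite sumr_ge0 //=.
  exact: sum_sgn (near_t p).
have ratio : 2 * (1 - e / 2) ^+ m <= (1 + e) ^+ m.
  rewrite -(ler_pM2l (exprn_gt0 m (ltr0n R 2))) mulrCA -!exprMn.
  by rewrite (le_trans _ upper) // (le_trans _ f_s0) // mulr2n; lra.
(* As m e = 1/4, the left-hand side of ratio is at least 7/4, but its right-hand
   side is at most 4/3. *)
have b1 : 1 - m%:R * (e / 2) <= (1 - e / 2) ^+ m by apply: bernoulli_sub; lra.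
have b2 : 1 - m%:R * e <= (1 - e) ^+ m by apply: bernoulli_sub; rewrite e0.
have b3 : (1 - e) ^+ m * (1 + e) ^+ m <= 1.
  by rewrite -exprMn exprn_ile1 //; nra.
have b4 : 0 <= (1 + e) ^+ m by rewrite exprn_ge0 // addr_ge0.
rewrite mulrA me in b1; rewrite me in b2; nra.
Qed.

Lemma exists_unmatched_signs D k (u : G -> T -> R) :
  (forall p, ratfun X D (u p)) -> (#|G| <= 2 ^ k)%N ->
  ((#|G| * (3 ^ k * D)).+1 ^ #|I| < 2 ^ #|G|)%N ->
  exists s : {ffun G -> bool}, forall t,
    exists p, 1 / 4 < `|u p t - (-1) ^+ s p|.
Proof.
move=> uD Gk card_lt.
have [s sP] := exists_unmatched_sharp_signs (fun p => ratfun_sharpen k (uD p))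
  card_lt.
exists s => t; have [p far] := sP t; exists p; rewrite ltNge;
  apply/negP => near_p.
have G0 : (0 < #|G|)%N by apply/card_gt0P; exists p.
have := @iter_sharpen_error_card _ _ _ #|G| k (sgn2 (s p)) _ near_p.
by rewrite G0 Gk leNgt far => /(_ isT).
Qed.

End SignPatterns.

(** * Logistic networks on a grid *)

Section GridNetworks.
Variables (R : realType) (d n N : nat).

Definition grid_point (p : {ffun 'I_d -> 'I_N}) : 'rV[R]_d :=
  \row_i ((p i)%:R / N%:R).

Definition weights : Type :=
  ('I_n -> R) * ('I_n -> R) * ('I_n -> 'rV[R]_d).

Definition network (t : weights) (x : 'rV[R]_d) : R :=
  \sum_(k < n) t.1.1 k * @logistic R (dotv (t.2 k) x + t.1.2 k).

Definition network_var (j : 'I_n + 'I_n + 'I_n * 'I_d) (t : weights) : R :=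
  match j with
  | inl (inl k) => t.1.1 k
  | inl (inr k) => expR (- t.1.2 k)
  | inr (k, i) => expR (- (t.2 k 0 i / N%:R))
  end.

(** On the grid, the exponential in the k-th unit is [expR (- c k)] times the
    product of the [p i]-th powers of [expR (- w k i / N)]; its exponents are
    integers at most [N]. *)
Lemma ratfun_network (p : {ffun 'I_d -> 'I_N}) : (0 < N)%N ->
  ratfun network_var (n * N) (fun t => network t (grid_point p)).
Proof.
move=> N0; rewrite -[X in (X * _)%N](card_ord n).
apply: ratfun_sum => k.
pose m (j : 'I_n + 'I_n + 'I_n * 'I_d) : nat :=
  match j with
  | inl (inl _) => 0%N
  | inl (inr k') => (k' == k)
  | inr (k', i) => if k' == k then nat_of_ord (p i) else 0%N
  end.
exists (fun t => t.1.1 k), (fun t => 1 + \prod_j network_var j t ^+ m j).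
have prodE t : \prod_j network_var j t ^+ m j =
    expR (- (dotv (t.2 k) (grid_point p) + t.1.2 k)).
  rewrite !big_sumType /= big1 // mul1r (bigD1 k) //= eqxx expr1.
  rewrite big1 ?mulr1; last first.
    by move=> k' k'k; rewrite (negPf k'k).
  rewrite [X in _ * X](_ : _ = \prod_k' \prod_i
      network_var (inr (k', i)) t ^+ m (inr (k', i))); last first.
    by rewrite pair_bigA; apply: eq_bigr => -[].
  rewrite (bigD1 k) //= [X in _ * (_ * X)]big1 ?mulr1; last first.
    by move=> k' k'k; rewrite big1 // => i _; rewrite (negPf k'k).
  rewrite eqxx opprD addrC expRD; congr (_ * _).
  rewrite /dotv -sumrN expR_sum; apply: eq_bigr => i _.
  by rewrite -expRM_natl mxE; congr expR; ring.
split.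
- apply: (@polyfun_ext _ _ _ _ _
    (fun t => \prod_j network_var j t ^+ (j == inl (inl k)))).
    move=> t; rewrite (bigD1 (inl (inl k))) //= eqxx expr1 big1 ?mulr1 //.
    by move=> j jk; rewrite (negPf jk).
  by apply: polyfun_monomial => j; apply: leq_trans N0; case: eqP.
- apply: polyfunD; first exact: polyfun_cst.
  apply: polyfun_monomial => -[[k'|k']|[k' i]] //=;
    first by apply: leq_trans N0; case: eqP.
  by case: ifP => // _; apply: ltnW.
- by move=> t; rewrite prodE addr_gt0 // expR_gt0.
- by move=> t; rewrite prodE /logistic mul1r.
Qed.

(** [F] is arbitrary because [(network - F) / A] is rational in the same
    variables, with the same degree, as the network. *)
Lemma grid_signs_not_approximated k (F : {ffun 'I_d -> 'I_N} -> R) (A : R) :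
  (0 < N)%N -> 0 < A -> (N ^ d <= 2 ^ k)%N ->
  ((N ^ d * (3 ^ k * (n * N))).+1 ^ (n * (d + 2)) < 2 ^ (N ^ d))%N ->
  exists s : {ffun {ffun 'I_d -> 'I_N} -> bool},
    forall g, networks (@logistic R) d n g ->
    exists p, A / 4 < `|F p + A * (-1) ^+ s p - g (grid_point p)|.
Proof.
move=> N0 A0 Nk card_lt.
have cardG : #|{ffun 'I_d -> 'I_N}| = (N ^ d)%N by rewrite card_ffun !card_ord.
have cardI : #|{: 'I_n + 'I_n + 'I_n * 'I_d}| = (n * (d + 2))%N.
  by rewrite !card_sum card_prod !card_ord; ring.
have [|//||s sP] := @exists_unmatched_signs R weights _ _ network_var (n * N) k
    (fun p t => (network t (grid_point p) - F p) / A).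
- by move=> p; apply: ratfun_affine; apply: ratfun_network.
- by rewrite cardG.
- by rewrite cardG cardI.
exists s => _ [a [c [w ->]]]; have [p far] := sP (a, c, w); exists p.
move: far; rewrite -[\sum_(i < n) _]/(network (a, c, w) (grid_point p)).
move: (network _ _) (F p) ((-1) ^+ s p) => y f e far.
have -> : f + A * e - y = - ((y - f) / A - e) * A by field; rewrite gt_eqF.
by rewrite normrM normrN (gtr0_norm A0) [A / 4]mulrC ltr_pM2r // -[4^-1]mul1r.
Qed.

End GridNetworks.

(** * Finite differences and derivatives on a line *)

Section Differences.
Variable R : realType.
Implicit Types u : R -> R.

Fixpoint diffs (k : nat) u (t : R) : R :=
  if k is k'.+1 then diffs k' u (t + 1) - diffs k' u t else u t.

Lemma diffsE k u t :
  diffs k u t = \sum_(j < k.+1) (-1) ^+ (k - j) * 'C(k, j)%:R * u (t + j%:R).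
Proof.
elim: k t => [|k IHk] t /=.
  by rewrite big_ord1 subnn expr0 bin0 !mul1r addr0.
rewrite !IHk [RHS]big_ord_recl /= subn0 bin0 mulr1 addr0.
under [in RHS]eq_bigr => j _.
  rewrite /bump /= add1n subSS binS natrD mulrDr mulrDl.
  rewrite -[j.+1]add1n natrD addrA; over.
rewrite big_split /= addrCA addrA -[LHS]addrC; congr (_ + _).
rewrite big_ord_recl [in RHS]big_ord_recr /= (@bin_small k (1 + k)) //.
rewrite mulr0 mul0r addr0.
rewrite addr0 subn0 bin0 mulr1 opprD addrC exprS mulN1r mulNr; congr (_ + _).
rewrite -sumrN; apply: eq_bigr => j _ /=; rewrite /bump /= add1n.
have -> : t + j.+1%:R = t + 1 + j%:R by rewrite -addrA nat1r.
have -> : (k - j = (k - j.+1).+1)%N by rewrite -subSn ?subSS // ltn_ord.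
by rewrite exprS; ring.
Qed.

Lemma is_derive_diffs k u u' : (forall t : R, is_derive t 1 u (u' t)) ->
  forall t : R, is_derive t 1 (diffs k u) (diffs k u' t).
Proof.
move=> du; elim: k => [//|k IHk] t /=.
apply: is_deriveB.
have d1 : is_derive t 1 (fun s : R => s + 1) 1.
  by rewrite -[X in is_derive _ _ _ X]addr0; apply: is_deriveD.
by rewrite -[X in is_derive _ _ _ X]mulr1; exact: (is_derive1_comp (IHk _) d1).
Qed.

(** The j-th derivative, for [j <= k], is bounded by [L ^+ j * b].  The bound
    [b] is a function, not a constant: the bumps are then summed together with
    the indicators of their disjoint supports, and the number of bumps does not
    enter the bound of the sum. *)
Fixpoint derivs_bounded (k : nat) (L : R) (b u : R -> R) : Prop :=
  (forall t, `|u t| <= b t) /\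
  if k is k'.+1 then
    exists u' : R -> R, (forall t : R, is_derive t 1 u (u' t)) /\
      derivs_bounded k' L (fun t => L * b t) u'
  else True.

(** Each difference is a derivative at an intermediate point. *)
Lemma diffs_le k L B u : derivs_bounded k L (fun=> B) u ->
  forall t, `|diffs k u t| <= B * L ^+ k.
Proof.
elim: k B u => [|k IHk] B u /= [ub].
  by move=> _ t; rewrite mulr1.
move=> [u' [du /IHk u'b]] t.
have dU := is_derive_diffs k du.
have [||c _ ->] := @MVT R (diffs k u) (diffs k u') t (t + 1); rewrite ?ltrDl //.
  by apply: derivable_within_continuous => x _; have [] := dU x.
rewrite addrAC subrr add0r mulr1 exprS mulrA [B * L]mulrC; exact: u'b.
Qed.

Lemma derivs_bounded_le k L b b' u : 0 <= L -> (forall t, b t <= b' t) ->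
  derivs_bounded k L b u -> derivs_bounded k L b' u.
Proof.
move=> L0; elim: k b b' u => [|k IHk] b b' u bb' /= [ub].
  by move=> _; split=> // t; apply: le_trans (ub t) (bb' t).
move=> [u' [du u'b]]; split=> [t|]; first exact: le_trans (ub t) (bb' t).
exists u'; split=> //; apply: IHk u'b => t; exact: ler_wpM2l.
Qed.

Lemma derivs_boundedD k L b b' u u' :
  derivs_bounded k L b u -> derivs_bounded k L b' u' ->
  derivs_bounded k L (fun t => b t + b' t) (fun t => u t + u' t).
Proof.
elim: k b b' u u' => [|k IHk] b b' u u' /= [ub Hu] [ub' Hu'].
  by split=> // t; rewrite (le_trans (ler_normD _ _)) // lerD.
split=> [t|]; first by rewrite (le_trans (ler_normD _ _)) // lerD.
have [[v [dv vb]] [v' [dv' vb']]] := (Hu, Hu').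
exists (fun t => v t + v' t); split=> [t|]; first exact: is_deriveD.
under eq_fun do rewrite mulrDr.
exact: IHk.
Qed.

Lemma derivs_boundedZ k L a b u :
  derivs_bounded k L b u ->
  derivs_bounded k L (fun t => `|a| * b t) (fun t => a * u t).
Proof.
elim: k b u => [|k IHk] b u /= [ub Hu].
  by split=> // t; rewrite normrM ler_wpM2l.
split=> [t|]; first by rewrite normrM ler_wpM2l.
have [v [dv vb]] := Hu.
exists (fun t => a * v t); split=> [t|]; first exact: is_deriveZ.
under eq_fun do rewrite mulrCA.
exact: IHk.
Qed.

Lemma derivs_bounded0 k L : derivs_bounded k L (fun=> 0) (fun=> 0).
Proof.
elim: k => [|k IHk] /=; split=> //; try by move=> t; rewrite normr0.
exists (fun=> 0); split; first by move=> t; exact: is_derive_cst.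
by under eq_fun do rewrite mulr0.
Qed.

Lemma derivs_bounded_sum k L (J : finType) (b u : J -> R -> R) :
  (forall j, derivs_bounded k L (b j) (u j)) ->
  derivs_bounded k L (fun t => \sum_j b j t) (fun t => \sum_j u j t).
Proof.
move=> H; elim: (index_enum J) => [|j s IHs].
  under eq_fun do rewrite big_nil; under [u in derivs_bounded _ _ _ u]eq_fun do
    rewrite big_nil.
  exact: derivs_bounded0.
under eq_fun do rewrite big_cons; under [u in derivs_bounded _ _ _ u]eq_fun do
  rewrite big_cons.
exact: derivs_boundedD.
Qed.

End Differences.

(** * Truncated powers of quadratic functions *)

Section TruncatedPowers.
Variable R : realType.

Definition pospart (x : R) : R := Num.max 0 x.

Lemma is_derive_quadratic_remainder (u : R -> R) (x d : R) :
  (forall h, `|u (x + h) - u x - h * d| <= h ^+ 2) -> is_derive x 1 u d.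
Proof.
move=> H.
have cv : h^-1 *: (u (h *: 1 + x) - u x) @[h --> 0^'] --> d.
  apply/cvgrPdist_le => e e0; near=> h.
  have h0 : h != 0 by near: h; exact: nbhs_dnbhs_neq.
  have he : `|h| <= e by near: h; exact: dnbhs0_le.
  have := H h; rewrite [h *: 1]mulr1 [h + x]addrC.
  set w := u (x + h) - u x => Hh.
  have -> : d - h^-1 *: w = - (h^-1 * (w - h * d)).
    by rewrite /GRing.scale /=; field.
  rewrite normrN normrM normfV ler_pdivrMl ?normr_gt0 //.
  apply: le_trans Hh _; rewrite -(ger0_norm (sqr_ge0 h)) expr2 normrM;
    exact: ler_wpM2l.
split; first by apply/cvg_ex; exists d.
exact: cvg_lim.
Unshelve. all: by end_near.
Qed.

(** The linear approximation of the square has an error at most [h ^+ 2] at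
    every point, 0 included; higher powers follow from
    [pospart y ^+ b.+3 = y * pospart y ^+ b.+2]. *)
Lemma is_derive_pospartX (b : nat) (x : R) :
  is_derive x 1 (fun y => pospart y ^+ b.+2) (b.+2%:R * pospart x ^+ b.+1).
Proof.
elim: b x => [|b IHb] x.
  apply: is_derive_quadratic_remainder => h; rewrite /pospart expr1.
  rewrite ler_norml; apply/andP.
  by case: (leP 0 x); case: (leP 0 (x + h)) => *; split; nra.
have pE y : pospart y ^+ b.+3 = y * pospart y ^+ b.+2.
  rewrite exprS /pospart; case: leP => // _; by rewrite !exprS !mul0r mulr0.
under eq_fun do rewrite pE.
have := is_deriveM (is_derive_id x 1) (IHb x).
congr (is_derive _ _ _ _); rewrite /GRing.scale /= mulr1.
have pE' : pospart x ^+ b.+2 = x * pospart x ^+ b.+1.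
  rewrite exprS /pospart; case: leP => // _; by rewrite !exprS !mul0r mulr0.
by rewrite mulrCA -pE' -[X in _ + X]mul1r -mulrDl natr1.
Qed.

(** The derivative of [L ^ a * Q_+ ^ b] is a combination of
    [c * L ^ (a - 1) * Q_+ ^ b] and [L ^ (a + 1) * Q_+ ^ (b - 1)].  Both terms
    are homogeneous of degree [a + 1] if [L] has degree 1 and [c] degree 2, so
    each derivative costs one factor [lam] and one power of [Q_+]. *)
Lemma derivs_bounded_truncated k a b : (k < b)%N ->
  exists2 C : R, 0 <= C & forall (Q L : R -> R) (c lam : R), 0 <= lam ->
    (forall t : R, is_derive t 1 Q (L t)) ->
    (forall t : R, is_derive t 1 L c) ->
    `|c| <= lam ^+ 2 -> (forall t, Q t <= 1) ->
    (forall t, 0 < Q t -> `|L t| <= lam) ->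
    derivs_bounded k lam (fun t => C * lam ^+ a * (0 < Q t)%R%:R)
      (fun t => L t ^+ a * pospart (Q t) ^+ b).
Proof.
have bound0 (C q l lam : R) a' b' : 0 <= lam -> q <= 1 ->
    (0 < q -> `|l| <= lam) -> 1 <= C ->
    `|l ^+ a' * pospart q ^+ b'.+1| <= C * lam ^+ a' * (0 < q)%R%:R.
  move=> lam0 q1 ql C1; rewrite /pospart; case: ltP => q0.
    rewrite mulr1 normrM !normrX (gtr0_norm q0).
    apply: (@le_trans _ _ (lam ^+ a' * 1)).
      have q0' := ltW q0.
      apply: ler_pM; rewrite ?exprn_ge0 ?exprn_ile1 //.
      by rewrite lerXn2r ?nnegrE //; exact: ql.
    by rewrite mulr1 ler_peMl // exprn_ge0.
  by rewrite exprS mul0r !mulr0 normr0.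
elim: k a b => [|k IHk] a [//|b] kb.
  by exists 1 => // Q L c lam lam0 dQ dL cl Q1 QL; split=> // t; apply: bound0;
    auto.
case: b kb => [//|b] kb.
have [C1 C10 H1] := IHk a.-1 b.+2 (ltnW kb).
have [C2 C20 H2] := IHk a.+1 b.+1 kb.
exists (1 + a%:R * C1 + b.+2%:R * C2).
  by rewrite !addr_ge0 // mulr_ge0.
move=> Q L c lam lam0 dQ dL cl Q1 QL; split.
  by move=> t; apply: bound0; auto; rewrite -addrA lerDl addr_ge0 // mulr_ge0.
exists (fun t => (a%:R * c) * (L t ^+ a.-1 * pospart (Q t) ^+ b.+2) +
   b.+2%:R * (L t ^+ a.+1 * pospart (Q t) ^+ b.+1)); split=> [t|].
  have dP := is_derive1_comp (is_derive_pospartX b (Q t)) (dQ t).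
  have -> : (fun s => L s ^+ a * pospart (Q s) ^+ b.+2) =
      (L ^+ a) * ((fun y => pospart y ^+ b.+2) \o Q).
    by apply/funext => s; rewrite exprfctE.
  apply: is_derive_eq (is_deriveM (is_deriveX a (dL t)) dP) _.
  rewrite /GRing.scale /= exprfctE (exprS (L t)); ring.
have Hsum := derivs_boundedD
  (derivs_boundedZ (a%:R * c) (H1 _ _ _ _ lam0 dQ dL cl Q1 QL))
  (derivs_boundedZ b.+2%:R (H2 _ _ _ _ lam0 dQ dL cl Q1 QL)).
apply: derivs_bounded_le Hsum => // t.
case: (0 < Q t); rewrite ?mulr0 ?addr0 // !mulr1.
rewrite normrM !(ger0_norm (ler0n _ _)).
have l1 : 0 <= lam ^+ a.+1 by rewrite exprn_ge0.
have : a%:R * `|c| * (C1 * lam ^+ a.-1) <= a%:R * C1 * lam ^+ a.+1.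
  case: (a) => [|a']; first by rewrite !mul0r.
  rewrite -!mulrA ler_wpM2l // mulrCA ler_wpM2l //= !exprS.
  by rewrite mulrA -expr2 ler_wpM2r // exprn_ge0.
by rewrite (exprS lam a) in l1 *; nra.
Qed.

End TruncatedPowers.

(** * Signed bumps on a grid *)

Lemma continuous_fin_sum (R : realType) (T : topologicalType) (J : finType)
    (u : J -> T -> R) :
  (forall j, continuous (u j)) -> continuous (fun x => \sum_j u j x).
Proof.
move=> cu; elim: (index_enum J) => [|j s IHs].
  by under eq_fun do rewrite big_nil; move=> x; exact: cvg_cst.
by under eq_fun do rewrite big_cons; move=> x; apply: cvgD;
  [exact: cu | exact: IHs].
Qed.

Lemma is_derive_quadratic (R : realType) (A B E t : R) :
  is_derive t (1 : R) (fun s : R => A + B * s + E * (s * s)) (B + 2 * E * t).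
Proof.
apply: is_derive_eq (is_deriveD (is_deriveD (is_derive_cst A t 1)
  (is_deriveZ B (is_derive_id t (1 : R))))
  (is_deriveZ E (is_deriveM (is_derive_id t (1 : R))
    (is_derive_id t (1 : R))))) _.
by rewrite /GRing.scale /=; ring.
Qed.

Lemma diffs_le_sup (R : realType) k B (u : R -> R) : (forall t, `|u t| <= B) ->
  forall t, `|diffs k u t| <= 2 ^+ k * B.
Proof.
move=> uB; elim: k => [|k IHk] t /=; first by rewrite mul1r.
rewrite (le_trans (ler_normB _ _)) // exprS.
have := IHk t; have := IHk (t + 1); lra.
Qed.

(** An r-th difference with step [nu] only involves the restriction of [f] to a
    line of direction [nu]; everything about bumps is proved on that line. *)
Lemma fdiff_diffs (R : realType) d r (nu : 'rV[R]_d) f x :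
  fdiff r nu f x = diffs r (fun t => f (x + t *: nu)) 0.
Proof. by rewrite diffsE; apply: eq_bigr => j _; rewrite add0r. Qed.

Lemma fdiff_le_sup (R : realType) d r (nu : 'rV[R]_d) f x B :
  (forall y, `|f y| <= B) -> `|fdiff r nu f x| <= 2 ^+ r * B.
Proof. by move=> fB; rewrite fdiff_diffs; apply: diffs_le_sup. Qed.

Section Bumps.
Variables (R : realType) (d : nat).

Lemma dotvv_ge0 (nu : 'rV[R]_d) : 0 <= dotv nu nu.
Proof. by apply: sumr_ge0 => i _; rewrite -expr2 sqr_ge0. Qed.

Lemma enorm_ge0 (nu : 'rV[R]_d) : 0 <= enorm nu.
Proof. exact: sqrtr_ge0. Qed.

Lemma sqr_enorm (nu : 'rV[R]_d) : enorm nu ^+ 2 = dotv nu nu.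
Proof. by rewrite sqr_sqrtr // dotvv_ge0. Qed.

Lemma sqr_entry_le (I : finType) (y : I -> R) i : y i ^+ 2 <= \sum_j y j ^+ 2.
Proof.
by rewrite (bigD1 i) //= lerDl; apply: sumr_ge0 => j _; rewrite sqr_ge0.
Qed.

Lemma entry_le_enorm (nu : 'rV[R]_d) i : `|nu 0 i| <= enorm nu.
Proof.
rewrite -sqrtr_sqr; apply: ler_wsqrtr.
have := sqr_entry_le (fun j => nu 0 j) i; rewrite /dotv.
by under eq_bigr do rewrite expr2.
Qed.

Variables (r N : nat).
Local Notation grid := {ffun 'I_d -> 'I_N}.

(** A paraboloid with maximum 1 at the grid point [p / N], positive exactly on
    the ball of radius [1 / (2 N)] around it; these balls are disjoint.  Its
    restriction to a line is a quadratic function of one variable. *)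
Definition bump_core (p : grid) (x : 'rV[R]_d) : R :=
  1 - 4 * \sum_i (N%:R * x 0 i - (p i)%:R) ^+ 2.

Definition bumps (s : {ffun grid -> bool}) (x : 'rV[R]_d) : R :=
  \sum_p (-1) ^+ s p * pospart (bump_core p x) ^+ r.+1.

Lemma bump_core_le1 p x : bump_core p x <= 1.
Proof.
rewrite /bump_core gerBl mulr_ge0 // sumr_ge0 // => i _; exact: sqr_ge0.
Qed.

Lemma bump_core_gt0 p x i : 0 < bump_core p x ->
  `|N%:R * x 0 i - (p i)%:R| < 1 / 2.
Proof.
rewrite /bump_core => h.
have := sqr_entry_le (fun j => N%:R * x 0 j - (p j)%:R) i => /= h'.
set y := _ - _ in h' *; have : y ^+ 2 < 1 / 4 by lra.
rewrite ltr_norml => hy; apply/andP; split; nra.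
Qed.

Lemma bump_core_disjoint p q x :
  0 < bump_core p x -> 0 < bump_core q x -> p = q.
Proof.
move=> px qx; apply/ffunP => i; apply: val_inj => /=.
have := bump_core_gt0 i px; have := bump_core_gt0 i qx.
rewrite !ltr_norml => /andP[q1 q2] /andP[p1 p2].
apply/eqP; rewrite eqn_leq; apply/andP.
by split; rewrite -ltnS -(ltr_nat R) -natr1; lra.
Qed.

Lemma sum_bump_core_gt0_le1 x : \sum_p (0 < bump_core p x)%R%:R <= 1 :> R.
Proof.
have [/existsP[p px]|/existsPn none] :=
    boolP [exists p : grid, 0 < bump_core p x].
  rewrite (bigD1 p) //= px big1 ?addr0 // => q qp.
  case: (ltP 0 (bump_core q x)) => // qx.
  by rewrite (bump_core_disjoint qx px) eqxx in qp.
by rewrite big1 // => p _; rewrite (negPf (none p)).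
Qed.

Lemma bumps_le1 s x : `|bumps s x| <= 1.
Proof.
apply: le_trans (sum_bump_core_gt0_le1 x).
rewrite (le_trans (ler_norm_sum _ _ _)) //; apply: ler_sum => p _.
rewrite normrM normr_sign mul1r /pospart; case: ltP => q0.
  by rewrite ger0_norm ?exprn_ge0 ?exprn_ile1 ?bump_core_le1 ?ltW.
by rewrite exprS mul0r normr0.
Qed.

Lemma bumps_grid_point s p : (0 < N)%N ->
  bumps s (grid_point R p) = (-1) ^+ s p.
Proof.
move=> N0; have core1 : bump_core p (grid_point R p) = 1.
  rewrite /bump_core big1 ?mulr0 ?subr0 // => i _.
  by rewrite mxE mulrC divfK ?subrr ?expr0n // pnatr_eq0 -lt0n.
rewrite /bumps (bigD1 p) //= core1 [X in _ + X]big1 ?addr0.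
  by rewrite /pospart max_r // expr1n mulr1.
move=> q qp; rewrite /pospart; case: ltP => [q0|_]; last first.
  by rewrite exprS mul0r mulr0.
have : q = p by apply: (@bump_core_disjoint _ _ (grid_point R p));
  rewrite ?core1.
by move/eqP; rewrite (negPf qp).
Qed.

Lemma continuous_bumps s : continuous (bumps s).
Proof.
have contX (u : 'rV[R]_d -> R) m :
    continuous u -> continuous (fun x => u x ^+ m).
  by move=> cu x; apply: (@continuous_comp _ _ _ u (fun y => y ^+ m));
    [exact: cu | exact: exprn_continuous].
have contC c (u : 'rV[R]_d -> R) :
    continuous u -> continuous (fun x => c * u x).
  move=> cu x; apply: (@continuousM R _ (fun=> c) u);
    first exact: cst_continuous.
  exact: cu.
apply: continuous_fin_sum => p; apply: (contC); apply: (contX) => x.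
apply: (@continuous_max R _ (fun=> 0) (bump_core p));
  first exact: cst_continuous.
have contB c (u : 'rV[R]_d -> R) :
    continuous u -> continuous (fun x => c - u x).
  move=> cu y; apply: (@continuousB _ _ _ (fun=> c) u);
    first exact: cst_continuous.
  exact: cu.
move: x; apply: (contB); apply: (contC); apply: continuous_fin_sum => i.
under eq_fun do rewrite -sqrrN opprB.
by apply: (contX); apply: (contB); apply: (contC); exact: coord_continuous.
Qed.

End Bumps.

(** Along the line [x + t *: nu], the core has a derivative bounded by
    [4 * d * N * enorm nu] where it is positive, since there the coordinates of
    [N *: x - p] are at most 1/2. *)
Lemma fdiff_bumps_le (R : realType) (d r : nat) : (0 < d)%N ->
  exists2 C : R, 0 <= C & forall N s (nu x : 'rV[R]_d),
    `|fdiff r nu (@bumps R d r N s) x| <= C * (N%:R * enorm nu) ^+ r.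
Proof.
move=> d0; have [C C0 H] := @derivs_bounded_truncated R r 0 r.+1 (ltnSn r).
exists (C * (4 * d%:R) ^+ r).
  by rewrite mulr_ge0 // exprn_ge0 // mulr_ge0.
move=> N s nu x; rewrite fdiff_diffs.
set lam := 4 * d%:R * (N%:R * enorm nu).
have Nnu0 : 0 <= N%:R * enorm nu by rewrite mulr_ge0 // enorm_ge0.
have lam0 : 0 <= lam by apply: mulr_ge0 Nnu0; rewrite mulr_ge0.
rewrite -mulrA -exprMn -/lam.
apply: (@diffs_le _ r lam C _ _ 0).
have H1 (p : {ffun 'I_d -> 'I_N}) :
    derivs_bounded r lam (fun t => C * (0 < bump_core p (x + t *: nu))%R%:R)
      (fun t => pospart (bump_core p (x + t *: nu)) ^+ r.+1).
  pose y i := N%:R * x 0 i - (p i)%:R.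
  pose al := \sum_i y i ^+ 2.
  pose be := \sum_i y i * (N%:R * nu 0 i).
  pose ga := N%:R ^+ 2 * dotv nu nu.
  have QE t : bump_core p (x + t *: nu) =
      1 - 4 * al + - 8 * be * t + - 4 * ga * (t * t).
    rewrite /bump_core /al /be /ga /dotv.
    transitivity (1 - 4 * \sum_i (y i ^+ 2 + 2 * t * (y i * (N%:R * nu 0 i)) +
        t * t * N%:R ^+ 2 * (nu 0 i * nu 0 i))).
      congr (1 - 4 * _); apply: eq_bigr => i _; rewrite !mxE /y; ring.
    rewrite !big_split /= -!mulr_sumr; ring.
  have LE t : - 8 * be + 2 * (- 4 * ga) * t =
      - 8 * \sum_i (N%:R * (x + t *: nu) 0 i - (p i)%:R) * (N%:R * nu 0 i).
    rewrite /be /ga /dotv.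
    transitivity (- 8 * \sum_i (y i * (N%:R * nu 0 i) +
        t * N%:R ^+ 2 * (nu 0 i * nu 0 i))).
      rewrite big_split /= -!mulr_sumr; ring.
    congr (- 8 * _); apply: eq_bigr => i _; rewrite !mxE /y; ring.
  pose L t := - 8 * be + 2 * (- 4 * ga) * t.
  have -> : (fun t => pospart (bump_core p (x + t *: nu)) ^+ r.+1) =
      (fun t => L t ^+ 0 * pospart (bump_core p (x + t *: nu)) ^+ r.+1).
    by apply/funext => t; rewrite mul1r.
  rewrite -[C]mulr1 -[X in _ * X](expr0 lam).
  apply: (H (fun t => bump_core p (x + t *: nu)) L (2 * (- 4 * ga)) lam lam0)
    => [t|t||t|t Q0].
  - rewrite (funext QE); exact: is_derive_quadratic.
  - have := is_derive_quadratic (- 8 * be) (2 * (- 4 * ga)) 0 t.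
    rewrite mulr0 mul0r addr0; congr (is_derive _ _ _ _).
    by apply/funext => s'; rewrite mul0r addr0.
  - rewrite /ga -sqr_enorm -exprMn -/(N%:R * _) /lam.
    have -> : 2 * (- 4 * (N%:R * enorm nu) ^+ 2) =
        - (8 * (N%:R * enorm nu) ^+ 2) by ring.
    have sq0 : 0 <= (N%:R * enorm nu) ^+ 2 by exact: sqr_ge0.
    rewrite normrN (ger0_norm (mulr_ge0 (ler0n _ 8) sq0)) [X in _ <= X]exprMn.
    rewrite ler_wpM2r //.
    have : (1 : R) <= d%:R by rewrite ler1n.
    nra.
  - exact: bump_core_le1.
  - rewrite /L LE normrM normrN (ger0_norm (ler0n R 8)).
    apply: (@le_trans _ _ (8 * \sum_(i < d) (1 / 2 * (N%:R * enorm nu)))).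
      rewrite ler_wpM2l // (le_trans (ler_norm_sum _ _ _)) //;
        apply: ler_sum => i _.
      rewrite normrM ler_pM // ?(ltW (bump_core_gt0 _ Q0)) //.
      by rewrite normrM ger0_norm // ler_wpM2l // entry_le_enorm.
    by rewrite sumr_const card_ord -mulr_natl /lam; lra.
have -> : (fun t => bumps r s (x + t *: nu)) = (fun t =>
    \sum_p (-1) ^+ s p * pospart (bump_core p (x + t *: nu)) ^+ r.+1) by [].
apply: derivs_bounded_le (derivs_bounded_sum
  (fun p => derivs_boundedZ ((-1) ^+ s p) (H1 p))) => // t.
under eq_bigr do rewrite normr_sign mul1r.
by rewrite -mulr_sumr ler_piMr // sum_bump_core_gt0_le1.
Qed.

(** * Abstract moduli of smoothness *)

Section AbstractModulus.
Variables (R : realType) (omega : R -> R).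
Hypothesis omegaP : abstract_modulus omega.

Lemma near_at_right0 (P : R -> Prop) : (\forall t \near 0^'+, P t) ->
  exists2 e : R, 0 < e & forall t, 0 < t < e -> P t.
Proof.
move=> [e /= e0 He]; exists e => // t /andP[t0 te].
by apply: He => //=; rewrite sub0r normrN gtr0_norm.
Qed.

Lemma modulus_gt0 t : 0 < t -> 0 < omega t.
Proof. by case: omegaP => _ _ _ _ H t0; case: (H t t t0 t0). Qed.

Lemma modulus_le s t : 0 <= s -> s <= t -> omega s <= omega t.
Proof.
case: omegaP => _ _ H _ _ s0 st; apply: H => //.
  by rewrite in_itv /= s0.
by rewrite in_itv /= (le_trans s0).
Qed.

Lemma modulus_mulrn t k : 0 < t -> omega (k.+1%:R * t) <= k.+1%:R * omega t.
Proof.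
move=> t0; elim: k => [|k IHk]; first by rewrite !mul1r.
rewrite -[in omega _]natr1 -[in X in _ <= X]natr1 !mulrDl !mul1r.
have [_ _ _ _ /(_ (k.+1%:R * t) t)[]] := omegaP; rewrite ?mulr_gt0 //.
by move=> _ _ /le_trans; apply; rewrite lerD2r.
Qed.

(** [s] lies below the multiple [k.+1%:R * t] of [t], which is at most [2 * s];
    so [omega s / s] is decreasing up to a factor 2. *)
Lemma modulus_ratio s t : 0 < t -> t <= s -> omega s / s * t <= 2 * omega t.
Proof.
move=> t0 ts; have s0 := lt_le_trans t0 ts.
pose k := Num.trunc (s / t).
have st0 : 0 <= s / t by rewrite divr_ge0 // ltW.
have /andP[k1 k2] : k%:R <= s / t < k.+1%:R by exact: truncn_itv.
rewrite ler_pdivlMr // in k1; rewrite ltr_pdivrMr // in k2.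
have h1 : omega s <= k.+1%:R * omega t.
  by apply: le_trans (modulus_mulrn k t0); apply: modulus_le; apply: ltW.
have h2 : k.+1%:R * t <= 2 * s by rewrite -natr1 mulrDl mul1r; lra.
rewrite mulrAC ler_pdivrMr //.
apply: (@le_trans _ _ (k.+1%:R * omega t * t));
  first by rewrite ler_wpM2r // ltW.
by rewrite mulrAC -[2 * _ * _]mulrAC ler_wpM2r // ltW // modulus_gt0.
Qed.

Lemma modulus_small e : 0 < e ->
  exists2 h : R, 0 < h & forall t, 0 < t < h -> omega t <= e.
Proof.
move=> e0; case: omegaP => _ /continuous_within_itvcyP[_ cv0] _ w0 _.
apply: near_at_right0; rewrite w0 in cv0.
have /cvgrPdist_le/(_ _ e0) := cv0; apply: filterS => t.
by rewrite sub0r normrN => /(le_trans (ler_norm _)).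
Qed.

Lemma modulus_ratio_large : omega t / t @[t --> 0^'+] --> +oo ->
  forall M : R, exists2 h : R, 0 < h & forall t, 0 < t < h -> M <= omega t / t.
Proof. by move=> /cvgryPge lim M; apply: near_at_right0; exact: lim. Qed.

End AbstractModulus.

(** * The gliding hump *)

Lemma continuous_of_uniform_approx (R : realType) (T : topologicalType)
    (f : T -> R) :
  (forall eps, 0 < eps -> exists2 F : T -> R, continuous F &
     forall x, `|f x - F x| <= eps) -> continuous f.
Proof.
move=> H x; apply/cvgrPdist_le => eps eps0.
have [|F cF fF] := H (eps / 3); first by rewrite divr_gt0.
have /cvgrPdist_le/(_ (eps / 3)) := cF x; rewrite divr_gt0 // => /(_ isT).
apply: filterS => y; have := fF x; have := fF y; rewrite !ler_norml.
move=> /andP[h1 h2] /andP[h3 h4] /andP[h5 h6]; apply/andP; split; lra.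
Qed.

Section GlidingHump.
Variables (R : realType) (d r : nat) (omega : R -> R).
Hypotheses (omegaP : abstract_modulus omega)
  (omega_lim : omega t / t @[t --> 0^'+] --> +oo).
Variables (phi : nat -> R).
Hypotheses (phi_gt0 : forall e, 0 < phi e)
  (phi_small : forall h : R, 0 < h ->
    forall e, exists2 e', (e < e')%N & phi e' < h).

Let A e := omega (phi e).

Let A_gt0 e : 0 < A e. Proof. exact: modulus_gt0. Qed.

(** By the third condition the humps that follow are small compared with the
    present one; by the last one the slopes [A / phi] of the preceding humps
    together do not exceed the present slope. *)
Lemma lacunary_subsequence : exists e_ : nat -> nat, forall j,
  [/\ (j <= e_ j)%N, phi (e_ j.+1) < phi (e_ j), 16 * A (e_ j.+1) <= A (e_ j) &
      2 * (A (e_ j) / phi (e_ j)) <= A (e_ j.+1) / phi (e_ j.+1)].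
Proof.
have step e : exists e', [/\ (e < e')%N, phi e' < phi e, 16 * A e' <= A e &
    2 * (A e / phi e) <= A e' / phi e'].
  have [|h1 h10 H1] := modulus_small omegaP (_ : 0 < A e / 16).
    by rewrite divr_gt0.
  have [h2 h20 H2] := modulus_ratio_large omega_lim (2 * (A e / phi e)).
  have [|e' ee' e'h] := phi_small (_ : 0 < Num.min (phi e) (Num.min h1 h2)) e.
    by rewrite !lt_min phi_gt0 h10.
  move: e'h; rewrite !lt_min => /and3P[l0 l1 l2].
  exists e'; split => //.
    have : A e' <= A e / 16 by apply: H1; rewrite phi_gt0.
    lra.
  by apply: H2; rewrite phi_gt0.
have [nxt nxtP] := choice step.
exists (fun j => iter j nxt 0%N) => j /=.
have [_ ? ? ?] := nxtP (iter j nxt 0%N); split => //.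
elim: (j) => //= i IHi; apply: leq_ltn_trans IHi _.
by have [] := nxtP (iter i nxt 0%N).
Qed.

Variables (S : nat -> set ('rV[R]_d -> R)) (K : set 'rV[R]_d) (C : R).
Hypotheses (C_ge0 : 0 <= C)
  (hump : forall e (F : 'rV[R]_d -> R), exists g : 'rV[R]_d -> R,
    [/\ continuous g, forall x, `|g x| <= 1,
        forall nu x, `|fdiff r nu g x| <= C * enorm nu ^+ r / phi e &
        forall h, S e h ->
        exists2 x, K x & A e / 4 <= `|F x + A e * g x - h x|]).

Lemma fdiffD (nu : 'rV[R]_d) f g x :
  fdiff r nu (fun y => f y + g y) x = fdiff r nu f x + fdiff r nu g x.
Proof. by rewrite -big_split; apply: eq_bigr => j _; rewrite mulrDr. Qed.

Lemma fdiffZ (nu : 'rV[R]_d) a f x :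
  fdiff r nu (fun y => a * f y) x = a * fdiff r nu f x.
Proof. by rewrite mulr_sumr; apply: eq_bigr => j _; rewrite mulrCA. Qed.

(** The classes [S e] enter only through [hump]: any function [F] can be
    perturbed by [A e] times a function of size 1 and scale [phi e] so as to
    become [A e / 4]-far from [S e].  At each step [F] is the sum of the
    preceding humps. *)
Lemma gliding_hump : exists f : 'rV[R]_d -> R,
  [/\ continuous f,
      exists M, forall x, `|f x| <= M,
      exists2 B, 0 <= B & forall (delta : R) nu x,
        0 < delta -> enorm nu <= delta ->
        `|fdiff r nu f x| <= B * omega (delta ^+ r) &
      forall e0, exists2 e, (e0 <= e)%N & forall h, S e h ->
        exists2 x, K x & A e / 8 <= `|f x - h x|].
Proof.
have [e_ e_P] := lacunary_subsequence.
have hump' (eF : nat * ('rV[R]_d -> R)) := hump eF.1 eF.2.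
have [G GP] := choice hump'.
pose fix F (j : nat) : 'rV[R]_d -> R :=
  if j is i.+1 then fun x => F i x + A (e_ i) * G (e_ i, F i) x else fun=> 0.
pose a j := A (e_ j); pose g j := G (e_ j, F j); pose p j := phi (e_ j).
have FS j x : F j.+1 x = F j x + a j * g j x by [].
have gP j : [/\ continuous (g j), forall x, `|g j x| <= 1,
    forall nu x, `|fdiff r nu (g j) x| <= C * enorm nu ^+ r / p j &
    forall h, S (e_ j) h -> exists2 x, K x & a j / 4 <= `|F j.+1 x - h x|] :=
      GP (e_ j, F j).
have a0 j : 0 < a j by exact: A_gt0.
have a16 j : 16 * a j.+1 <= a j by have [] := e_P j.
have step j x : `|F j.+1 x - F j x| <= a j.
  rewrite FS addrAC subrr add0r normrM gtr0_norm // ler_piMr ?(ltW (a0 j)) //.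
  by have [] := gP j.
have tail k j x : `|F (j + k)%N x - F j x| <= 2 * a j.
  elim: k j => [|k IHk] j; first by rewrite addn0 subrr normr0 mulr_ge0 // ltW.
  rewrite addnS -addSn; have := IHk j.+1; have := step j x; have := a16 j;
    have := a0 j.
  have := ler_distD (F j.+1 x) (F (j.+1 + k)%N x) (F j x).
  move: (F (j.+1 + k)%N x) => z; lra.
have tail' i j x : F i x - 2 * a i <= F j x + 2 * a j.
  have [ij|/ltnW ji] := leqP i j.
    have := tail (j - i)%N i x; rewrite subnKC // ler_distl => /andP[h _].
    have := a0 j; have := a0 i; lra.
  have := tail (i - j)%N j x; rewrite subnKC // ler_distl => /andP[_ h].
  have := a0 j; have := a0 i; lra.
(* F i x - 2 * a i increases with i and F i x + 2 * a i decreases, so that the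
   supremum is the sum of the series and is within 2 * a j of F j x. *)
pose f x := sup [set F i x - 2 * a i | i in [set: nat]].
have fF j x : `|f x - F j x| <= 2 * a j.
  rewrite ler_distl; apply/andP; split.
    apply: ub_le_sup; last by exists j.
    by exists (F 0%N x + 2 * a 0%N) => _ [i _ <-]; exact: tail'.
  apply: ge_sup; first by exists (F 0%N x - 2 * a 0%N); exists 0%N.
  by move=> _ [i _ <-]; exact: tail'.
have a_small (h : R) : 0 < h -> exists j, a j <= h.
  move=> h0; have aj j : a j * j.+1%:R <= a 0%N.
    elim: j => [|j IHj]; first by rewrite mulr1.
    have : (1 : R) <= j.+1%:R by rewrite ler1n.
    move: IHj; rewrite -(natr1 j.+1); have := a16 j; have := a0 j.+1; nra.
  exists (Num.trunc (a 0%N / h)).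
  have := truncnS_gt (a 0%N / h); rewrite ltr_pdivrMr // => lt.
  set n := _.+1%:R in lt; have n0 : 0 < n by rewrite ltr0n.
  rewrite -(ler_pM2r n0); apply: le_trans (aj _) _; rewrite mulrC; exact: ltW.
exists f; split.
- apply: continuous_of_uniform_approx => eps eps0.
  have [|j aj] := a_small (eps / 2); first by rewrite divr_gt0.
  exists (F j); last by move=> x; apply: le_trans (fF j x) _; lra.
  elim: (j) => [y|i IHi y]; first exact: cst_continuous.
  apply: (@continuousD _ _ _ (F i) (fun x => a i * g i x)); first exact: IHi.
  apply: (@continuousM R _ (fun=> a i) (g i)); first exact: cst_continuous.
  by have [cg _ _ _] := gP i; exact: cg.
- by exists (2 * a 0%N) => x; rewrite -[f x]subr0; exact: (fF 0%N x).
- exists (6 * (2 ^+ r + C) + 2) => [|delta nu x delta0 nu_le].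
    by rewrite addr_ge0 // mulr_ge0 // addr_ge0 // exprn_ge0.
  set t := delta ^+ r; have t0 : 0 < t by rewrite exprn_gt0.
  have wt0 : 0 < omega t by exact: modulus_gt0.
  have p0 j : 0 < p j by exact: phi_gt0.
  pose fix B j := if j is i.+1 then B i + a i * Num.min 1 (t / p i) else 0.
  have FB j : `|fdiff r nu (F j) x| <= (2 ^+ r + C) * B j.
    elim: j => [|j IHj] /=.
      have := @fdiff_le_sup R d r nu (fun=> 0) x 0; rewrite !mulr0; apply.
      by move=> y; rewrite normr0.
    rewrite fdiffD (le_trans (ler_normD _ _)) // mulrDr lerD // fdiffZ.
    rewrite normrM gtr0_norm // mulrCA ler_wpM2l ?(ltW (a0 j)) //.
    have [_ g1 gd _] := gP j.
    have pr0 : 0 < 2 ^+ r :> R by rewrite exprn_gt0.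
    have tp0 : 0 < t / p j by rewrite divr_gt0.
    case: (leP 1 (t / p j)) => tp.
      by rewrite (le_trans (fdiff_le_sup r nu x g1)) // mulr1 mulr1 lerDl.
    apply: le_trans (gd nu x) _.
    have : enorm nu ^+ r / p j <= t / p j.
      by rewrite ler_wpM2r ?invr_ge0 ?(ltW (p0 j)) // lerXn2r // nnegrE
        ?enorm_ge0 // ltW.
    rewrite -mulrA => /(ler_wpM2l C_ge0) /le_trans; apply; nra.
  (* While phi_j >= t the sum is controlled by its last slope a j / p j; once
     phi_j < t, by omega t together with what the remaining terms may add. *)
  have BP j : (t <= p j -> B j <= t * (a j / p j)) /\
      (p j < t -> B j + 2 * a j <= 6 * omega t).
    elim: j => [|j [IH1 IH2]].
      split=> h /=; first by rewrite mulr_ge0 // ?divr_ge0 // ltW.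
      have : a 0%N <= omega t by apply: modulus_le => //; exact: ltW.
      lra.
    have [_ pj _ dbl] := e_P j.
    rewrite -/(p j) -/(p j.+1) in pj dbl; rewrite -/(a j) -/(a j.+1) in dbl.
    have st1 : B j.+1 <= B j + a j by 
      rewrite /= lerD2l ler_piMr ?ge_min ?lexx // ltW.
    have st2 : B j.+1 <= B j + t * (a j / p j).
      rewrite [B j.+1]/= lerD2l [t * (_ / _)]mulrCA ler_wpM2l ?ge_min ?lexx
        ?orbT // ltW //.
    split=> h.
      have := IH1 (ltW (le_lt_trans h pj)).
      have := ler_wpM2l (ltW t0) dbl; lra.
    have as1 : a j.+1 <= omega t by apply: modulus_le => //; exact: ltW.
    case: (leP t (p j)) => tpj; last first.
      by have := IH2 tpj; have := a16 j; have := a0 j.+1; lra.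
    have := IH1 tpj; have := modulus_ratio omegaP t0 tpj; rewrite -/(a j).
    by move: (a j / p j) => q in st2 *; lra.
  have [j aj] := a_small (omega t / 2 ^+ r.+1) (divr_gt0 wt0 (exprn_gt0 _
    (ltr0n _ 2))).
  have BJ : B j <= 6 * omega t.
    have [tpj|tpj] := leP t (p j); last first.
      by have [_ /(_ tpj)] := BP j; have := a0 j; lra.
    have [/(_ tpj) h1 _] := BP j; have := modulus_ratio omegaP t0 tpj.
    rewrite -/(a j); move: (a j / p j) h1 => q; lra.
  have -> : fdiff r nu f x =
      fdiff r nu (F j) x + fdiff r nu (fun y => f y - F j y) x.
    by rewrite -fdiffD; congr (fdiff _ _ _ _); apply/funext => y;
      rewrite addrC subrK.
  rewrite (le_trans (ler_normD _ _)) // mulrDl lerD //.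
    by rewrite (le_trans (FB j)) // [6 * _]mulrC -mulrA ler_wpM2l // addr_ge0
      // exprn_ge0.
  rewrite (le_trans (fdiff_le_sup r nu x (fF j))) //.
  move: aj; rewrite ler_pdivlMr ?exprn_gt0 // exprS; lra.
- move=> e0; exists (e_ e0); first by have [] := e_P e0.
  move=> h Sh; have [_ _ _ /(_ h Sh)[x Kx far]] := gP e0.
  exists x => //; have := fF e0.+1 x; have := a16 e0.
  rewrite -/(a e0); have := ler_distD (f x) (F e0.+1 x) (h x).
  rewrite (distrC (F _ x) (f x)); lra.
Qed.

End GlidingHump.

(** * Widths and grid sizes *)

Section HardScales.
Variables (d : nat).
Hypothesis d_gt0 : (0 < d)%N.

(** For these widths n, both n and [1 + log2 n = 2 ^ e] are powers of two, so
    that n (1 + log2 n) is compared with the number of grid points through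
    integer exponents. *)
Definition hard_width (e : nat) : nat := 2 ^ (2 ^ e).-1.

(** The grid has [2 ^ grid_exponent e] points per axis.  The exponent
    [(2 ^ e).-1 + e] of n (1 + log2 n), increased by [d + 10], is rounded up to
    a multiple of [d]; the constant [d + 10] is large enough for
    [quadratic_lt_exp2]. *)
Definition grid_exponent (e : nat) : nat :=
  (((2 ^ e).-1 + e + (d + 10)) %/ d).+1.

Lemma grid_exponent_bounds e :
  ((2 ^ e).-1 + e + (d + 10) <= grid_exponent e * d <=
    (2 ^ e).-1 + e + (d + 10) + d)%N.
Proof.
rewrite /grid_exponent mulSn; set x := (_ + (d + 10))%N.
have h1 := divn_eq x d; have h2 := ltn_pmod x d_gt0.
apply/andP; split; lia.
Qed.

Lemma quadratic_lt_exp2 : (10 * (d + 2) * (d + 6) < 2 ^ (d + 10))%N.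
Proof.
elim: d => [//|m IHm]; rewrite addSn expnS.
apply: (@leq_ltn_trans (2 * (10 * (m + 2) * (m + 6))));
  last by rewrite ltn_pmul2l.
nia.
Qed.

(** With [k] the binary logarithm of the number of grid points, the degree is
    below [2 ^ (5 * k)], so that the claim reduces to
    [5 * k * n * (d + 2) < 2 ^ k]. *)
Lemma hard_width_count e (n := hard_width e) (N := (2 ^ grid_exponent e)%N)
    (k := (grid_exponent e * d)%N) :
  ((N ^ d * (3 ^ k * (n * N))).+1 ^ (n * (d + 2)) < 2 ^ (N ^ d))%N.
Proof.
have /andP[kl ku] := grid_exponent_bounds e; rewrite -/k in kl ku.
have ek : (grid_exponent e <= k)%N by rewrite leq_pmulr.
have NE : (N ^ d = 2 ^ k)%N by rewrite -expnM.
have e2 : (e < 2 ^ e)%N by rewrite ltn_expl.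
have base : ((N ^ d * (3 ^ k * (n * N))).+1 <= 2 ^ (5 * k))%N.
  rewrite NE; apply: (@leq_ltn_trans (2 ^ k * (3 ^ k * (2 ^ k * 2 ^ k)))).
    rewrite !leq_mul // leq_exp2l //; lia.
  have -> : (2 ^ (5 * k) = 2 ^ k * (4 ^ k * (2 ^ k * 2 ^ k)))%N.
    by rewrite -[4%N]/(2 ^ 2)%N -expnM -!expnD; congr expn; lia.
  rewrite ltn_pmul2l ?expn_gt0 // ltn_pmul2r ?muln_gt0 ?expn_gt0 //.
  by rewrite ltn_exp2r //; apply: leq_trans ek.
have n0 : (0 < n)%N by rewrite expn_gt0.
apply: (@leq_ltn_trans ((2 ^ (5 * k)) ^ (n * (d + 2)))).
  by rewrite leq_exp2r // muln_gt0 n0 addn_gt0 orbT.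
rewrite -expnM ltn_exp2l // NE.
apply: (@leq_trans (2 ^ ((2 ^ e).-1 + e + (d + 10))));
  last by rewrite leq_exp2l.
rewrite expnD (expnD _ _ e) -/(hard_width e) -/n.
have q := quadratic_lt_exp2.
apply: (@leq_ltn_trans (n * (2 ^ e * (10 * (d + 2) * (d + 6))))).
  rewrite mulnCA leq_pmul2l //.
  have : (k <= 2 ^ e * (2 * d + 12))%N by nia.
  nia.
by rewrite mulnA ltn_pmul2l // muln_gt0 n0 expn_gt0.
Qed.

End HardScales.

Section Scales.
Variables (R : realType) (d r : nat).
Hypotheses (d_gt0 : (0 < d)%N) (r_gt0 : (0 < r)%N).

(** The argument of the modulus in the lower bound for networks of width [n]. *)
Definition rate (n : nat) : R :=
  1 / ((n%:R * (1 + log2 n%:R)) `^ (r%:R / d%:R)).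

Let T e : R := 2 ^+ ((2 ^ e).-1 + e).

Let T_gt0 e : 0 < T e. Proof. exact: exprn_gt0. Qed.

Lemma rate_hard_width e : rate (hard_width e) = (T e `^ (r%:R / d%:R))^-1.
Proof.
rewrite /rate mul1r; congr ((_ `^ _)^-1).
have ln2 : ln (2 : R) != 0 by rewrite gt_eqF // ln_gt0 // ltr1n.
rewrite /hard_width /log2 natrX; set l := (2 ^ e).-1.
have -> : ln (2 ^+ l : R) / ln 2 = l%:R.
  by rewrite lnXn // -[ln 2 *+ l]mulr_natl mulfK.
by rewrite nat1r /T exprD prednK ?expn_gt0 // natrX.
Qed.

Lemma rate_hard_width_gt0 e : 0 < rate (hard_width e).
Proof. by rewrite rate_hard_width invr_gt0 powR_gt0. Qed.

(** Comparisons with the rate are made between d-th powers, where no real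
    exponent remains. *)
Lemma rate_hard_widthX e : (rate (hard_width e))^-1 ^+ d = T e ^+ r.
Proof.
rewrite rate_hard_width invrK -(powR_mulrn d (powR_ge0 _ _)) -powRrM.
by rewrite divfK ?powR_mulrn ?ltW // pnatr_eq0 -lt0n.
Qed.

Lemma rate_hard_width_small (h : R) : 0 < h ->
  forall e, exists2 e', (e < e')%N & rate (hard_width e') < h.
Proof.
move=> h0 e; exists (maxn e (Num.trunc (h^-1 ^+ d))).+1.
  by rewrite ltnS leq_maxl.
set e' := _.+1; rewrite -ltf_pV2 ?posrE ?rate_hard_width_gt0 //.
rewrite ltNge; apply/negP => le_h.
have : (rate (hard_width e'))^-1 ^+ d <= h^-1 ^+ d.
  by rewrite lerXn2r // nnegrE ?invr_ge0 // ltW // rate_hard_width_gt0.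
rewrite rate_hard_widthX => le_h'.
have : h^-1 ^+ d < e'%:R.
  by rewrite (lt_le_trans (truncnS_gt _)) // ler_nat ltnS leq_maxr.
apply/negP; rewrite -leNgt; apply: le_trans le_h'.
have T1 : e'%:R <= T e'.
  rewrite /T -natrX ler_nat; apply: leq_trans (ltnW (ltn_expl e' (ltnSn 1))) _.
  by rewrite leq_exp2l // leq_addl.
apply: le_trans T1 _; rewrite -[X in X <= _]expr1 ler_weXn2l //.
by rewrite /T -natrX ler1n expn_gt0.
Qed.

Lemma grid_size_rate e : (2 ^+ grid_exponent d e) ^+ r <=
  2 ^+ ((2 * d + 10) * r) / rate (hard_width e).
Proof.
have /andP[_ ku] := grid_exponent_bounds d_gt0 e.
have rate0 := rate_hard_width_gt0 e.
rewrite -(ler_pXn2r d_gt0) ?nnegrE ?mulr_ge0 ?invr_ge0 ?exprn_ge0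
  ?(ltW rate0) //.
rewrite exprMn rate_hard_widthX /T -!exprM -exprD ler_weXn2l ?ler1n //.
rewrite mulnAC; apply: leq_trans (leq_mul ku (leqnn r)) _.
set c := ((2 ^ e).-1 + e)%N.
have : ((2 * d + 10) * r <= (2 * d + 10) * r * d)%N by rewrite leq_pmulr.
lia.
Qed.

End Scales.

(** * Suprema and approximation errors *)

Section Suprema.
Variable R : realType.

(** An unbounded or empty set has supremum 0 by convention. *)
Lemma sup_ge0 (E : set R) : (forall x, E x -> 0 <= x) -> 0 <= sup E.
Proof.
move=> E0; have [hE|/sup_out -> //] := pselect (has_sup E).
have [[x Ex] _] := hE; apply: le_trans (E0 x Ex) _.
exact: sup_upper_bound.
Qed.

Lemma sup_le_ub (E : set R) B : 0 <= B ->
  (forall x, E x -> x <= B) -> sup E <= B.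
Proof.
move=> B0 EB; have [->|/set0P E0] := eqVneq E set0; first by rewrite sup0.
exact: ge_sup.
Qed.

Lemma limn_esup_ge (u : nat -> \bar R) (c : \bar R) :
  (forall m, exists2 n, (m <= n)%N & (c <= u n)%E) -> (c <= limn_esup u)%E.
Proof.
move=> H; rewrite limn_esup_lim; apply: lime_ge; first exact: is_cvg_esups.
apply: nearW => m; have [n mn cn] := H m.
by apply: le_trans cn _; apply: ereal_sup_ubound; exists n.
Qed.

End Suprema.

Lemma logistic_ge0_le1 (R : realType) (x : R) : 0 <= logistic x <= 1.
Proof.
have e0 := expR_ge0 (- x).
by rewrite /logistic div1r invr_ge0 addr_ge0 //= invf_le1 ?lerDl // ltr_pwDl.
Qed.

Lemma networks_bounded (R : realType) d n (g : 'rV[R]_d -> R) :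
  networks (@logistic R) d n g -> exists M, forall x, `|g x| <= M.
Proof.
move=> [a [c [w ->]]]; exists (\sum_k `|a k|) => x.
rewrite (le_trans (ler_norm_sum _ _ _)) //; apply: ler_sum => k _.
have /andP[l0 l1] := logistic_ge0_le1 (dotv (w k) x + c k).
by rewrite normrM (ger0_norm l0) ler_piMr.
Qed.

Lemma approx_error_ge (R : realType) d n (f : 'rV[R]_d -> R) M c :
  (forall x, `|f x| <= M) ->
  (forall g, networks (@logistic R) d n g ->
     exists2 x, closed_cube R d x & c <= `|f x - g x|) ->
  c <= approx_error (networks (@logistic R) d n) f.
Proof.
move=> fM far; apply: lb_le_inf.
  pose g0 (x : 'rV[R]_d) := \sum_(k < n) 0 * @logistic R (dotv 0 x + 0).
  exists (sup_norm (closed_cube R d) (fun x => f x - g0 x)); exists g0 => //.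
  by exists (fun=> 0), (fun=> 0), (fun=> 0).
move=> _ [g Sg <-]; have [x Kx cx] := far g Sg.
have [M' gM] := networks_bounded Sg.
apply: le_trans cx _; apply: ub_le_sup; last by exists x.
exists (M + M') => _ [y _ <-].
by rewrite (le_trans (ler_normB _ _)) // lerD.
Qed.

Lemma grid_point_closed_cube (R : realType) d N (p : {ffun 'I_d -> 'I_N}) :
  closed_cube R d (grid_point R p).
Proof.
move=> i; rewrite mxE divr_ge0 //=.
have N0 : (0 < N)%N by apply: leq_ltn_trans (ltn_ord (p i)).
by rewrite ler_pdivrMr ?ltr0n // mul1r ler_nat ltnW.
Qed.

(** * The counterexample *)

(** The grid of [2 ^ grid_exponent d e] points per axis is fine enough for the
    counting argument and coarse enough for the r-th differences of its bumps
    to have scale [rate (hard_width e)]. *)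
Lemma exists_unapproximable_bumps (R : realType) (d r : nat) :
  (0 < d)%N -> (0 < r)%N ->
  exists2 C : R, 0 <= C & forall (e : nat) (A : R) (F : 'rV[R]_d -> R), 0 < A ->
  exists g : 'rV[R]_d -> R,
    [/\ continuous g, forall x, `|g x| <= 1,
        forall nu x, `|fdiff r nu g x| <=
          C * enorm nu ^+ r / rate R d r (hard_width e) &
        forall h, networks (@logistic R) d (hard_width e) h ->
        exists2 x, closed_cube R d x & A / 4 <= `|F x + A * g x - h x|].
Proof.
move=> d0 r0; have [C C0 HC] := @fdiff_bumps_le R d r d0.
exists (C * 2 ^+ ((2 * d + 10) * r)); first by rewrite mulr_ge0 // exprn_ge0.
move=> e A F A0; set N := (2 ^ grid_exponent d e)%N.
have N0 : (0 < N)%N by rewrite expn_gt0.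
have Nk : (N ^ d <= 2 ^ (grid_exponent d e * d))%N by rewrite -expnM.
have [s sP] := grid_signs_not_approximated (k := grid_exponent d e * d)
  (fun p => F (@grid_point R d N p)) N0 A0 Nk (hard_width_count d0 e).
exists (bumps r s); split; first exact: continuous_bumps.
- exact: bumps_le1.
- move=> nu x; apply: le_trans (HC N s nu x) _.
  have := grid_size_rate R d0 r0 e; rewrite -natrX -/N => size_le.
  rewrite exprMn -!mulrA ler_wpM2l // [X in _ <= X]mulrCA mulrC.
  by rewrite ler_wpM2l // exprn_ge0 // enorm_ge0.
- move=> h Sh; have [p far] := sP h Sh.
  exists (grid_point R p); first exact: grid_point_closed_cube.
  by rewrite bumps_grid_point // ltW.
Qed.

Theorem theorem3p3 (R : realType) (d r : nat) (hd : (0 < d)%N) (hr : (0 < r)%N)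
    (omega : R -> R) (homega : abstract_modulus omega)
    (hlim : omega delta / delta @[delta --> 0^'+] --> +oo) :
  exists f : 'rV[R]_d -> R,
    [/\ {within closed_cube R d, continuous f},
        (fun delta : R => radial_modulus (open_cube R d) r f delta)
          =O_ (0^'+) (fun delta : R => omega (delta ^+ r)) &
        (0 < limn_esup (fun n : nat =>
          (approx_error (networks (@logistic R) d n) f /
           omega (1 / ((n%:R * (1 + log2 n%:R)) `^ (r%:R / d%:R))))%:E))%E].
Proof.
have [C C0 hump] := exists_unapproximable_bumps R hd hr.
have rate0 := @rate_hard_width_gt0 R d r.
have A0 e : 0 < omega (rate R d r (hard_width e)) by exact: modulus_gt0.
have [f [cf [M fM] [B B0 fB] far]] := gliding_hump homega hlim rate0
  (@rate_hard_width_small R d r hd hr) C0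
  (fun e F => hump e _ F (A0 e)).
exists f; split; first exact: continuous_subspaceT.
- apply/eqOP; near=> k; near=> delta.
  have delta0 : 0 < delta by near: delta; exact: nbhs_right_gt.
  have w0 : 0 < omega (delta ^+ r) by apply: modulus_gt0 => //;
    exact: exprn_gt0.
  rewrite (gtr0_norm w0) ger0_norm; last first.
    apply: sup_ge0 => _ [nu _ <-]; apply: sup_ge0 => _ [x _ <-];
      exact: normr_ge0.
  apply: (@le_trans _ _ (B * omega (delta ^+ r))); last first.
    by rewrite ler_wpM2r ?(ltW w0) //; near: k; exact: nbhs_pinfty_ge.
  have Bw : 0 <= B * omega (delta ^+ r) by rewrite mulr_ge0 // ltW.
  apply: sup_le_ub => // _ [nu /= nu_le <-].
  apply: sup_le_ub => // _ [x _ <-]; exact: fB.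
- apply: (@lt_le_trans _ _ (1 / 8)%:E); first by rewrite lte_fin divr_gt0.
  apply: limn_esup_ge => m; have [e me farE] := far m.
  exists (hard_width e).
    apply: (leq_trans me); rewrite /hard_width.
    apply: leq_trans (ltn_expl _ (ltnSn 1)).
    by rewrite prednK ?expn_gt0 // ltnW // ltn_expl.
  rewrite lee_fin ler_pdivlMr; last exact: A0.
  apply: approx_error_ge fM _ => g /farE[x Kx gx]; exists x => //.
  by rewrite mul1r mulrC.
Unshelve. all: by end_near.
Qed.
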